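(* Let $M \subseteq \mathbb{N}$ be a numerical semigroup (a submonoid of $(\mathbb{N},+)$ with $\mathbb{N}\setminus M$ finite), and let $G_M$ be its gaps list, i.e. the list of the elements of $\mathbb{N}\setminus M$ sorted in strictly ascending order (without duplicates). Then $f_1(G_M)$ is the multiplicity of $M$, i.e. $f_1(G_M)$ is the minimum non-zero element of $M$.
   Context: For each $x \in \mathbb{N}$, the function $f_x$ from finite lists of natural numbers to $\mathbb{N}$ is defined recursively by: $f_x([\,]) = x$; $f_x(x :: t) = f_{x+1}(t)$; and $f_x(h :: t) = x$ if $h \neq x$. Here $[\,]$ is the empty list and $h :: t$ is the list with head $h$ and tail $t$. *)

(* Defs.v *)
(* MathComp, with the classical sets of MathComp-Analysis. *)
From mathcomp Require Import all_boot finmap.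
From mathcomp Require Import boolp classical_sets cardinality.

Set Implicit Arguments.
Unset Strict Implicit.
Unset Printing Implicit Defensive.

Local Open Scope classical_set_scope.

Record numerical_semigroup (M : set nat) : Prop := NumericalSemigroup {
  numerical_semigroup0 : M 0;
  numerical_semigroupD : forall m n : nat, M m -> M n -> M (m + n);
  numerical_semigroup_cofinite : finite_set (~` M)
}.

(* [fset_set] enumerates a finite set without duplicates, so that sorting by
   [leq] gives a strictly increasing list. It is the empty set on an infinite
   argument, hence [gaps M] is only meaningful when [~` M] is finite. *)
Definition gaps (M : set nat) : seq nat := sort leq (fset_set (~` M)).

Lemma gaps_sorted (M : set nat) : sorted ltn (gaps M).
Proof. by rewrite ltn_sorted_uniq_leq sort_uniq fset_uniq (sort_sorted leq_total). Qed.

Lemma mem_gaps (M : set nat) (n : nat) :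
  finite_set (~` M) -> n \in gaps M <-> ~ M n.
Proof. by move=> Mfin; rewrite mem_sort in_fset_set // in_setE. Qed.

Fixpoint f (x : nat) (s : seq nat) {struct s} : nat :=
  if s is h :: t then (if h == x then f x.+1 t else x) else x.

Definition is_multiplicity (M : set nat) (m : nat) : Prop :=
  [/\ M m, m <> 0 & forall n : nat, M n -> n <> 0 -> m <= n].

(* Main.v *)
Require Import Defs.
From mathcomp Require Import all_boot finmap.
From mathcomp Require Import boolp classical_sets cardinality.

(** On a strictly increasing list with entries at least [x], [f x] walks along the initial run [x],
    [x.+1], ... and stops at the least number from [x] on that is missing ([f_ge], [f_notin],
    [mem_lt_f]). For the gaps and [x = 1], missing means lying in [M]. *)

Lemma f_ge x s : x <= f x s.
Proof.
elim: s x => [|h t IHt] x //=; case: ifP => // _.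
exact: leq_trans (leqnSn x) (IHt x.+1).
Qed.

Lemma f_notin x s : sorted ltn s -> all (leq x) s -> f x s \notin s.
Proof.
elim: s x => [|h t IHt] x //= hts /andP[xh _].
have ht : all (ltn h) t by apply: order_path_min hts; apply: ltn_trans.
case: eqP => [hx|/eqP hx]; rewrite inE negb_or.
  rewrite hx in ht *; rewrite gtn_eqF ?f_ge //=.
  by apply: IHt => //; apply: path_sorted hts.
(* The scan stops at a head [h > x]; the tail lies above [h], so it cannot contain [x]. *)
rewrite eq_sym hx /=; apply/negP => /(allP ht) /=.
by rewrite ltnNge xh.
Qed.

(** The counter only moves past a value by consuming a head equal to it. *)
Lemma mem_lt_f x s n : x <= n < f x s -> n \in s.
Proof.
elim: s x => [|h t IHt] x /=; first by rewrite ltnNge => /andP[->].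
case: eqP => [->|_]; last by rewrite ltnNge => /andP[->].
case/andP; rewrite leq_eqVlt inE => /orP[/eqP->|xn] nf; first by rewrite eqxx.
by rewrite (IHt x.+1) ?orbT ?xn.
Qed.

Theorem theorem1 (M : set nat) (hM : numerical_semigroup M) :
  is_multiplicity M (f 1 (gaps M)).
Proof.
case: hM => M0 _ Mfin.
have gapsP n := mem_gaps n Mfin.
have gaps_gt0 : all (leq 1) (gaps M).
  (* Since [M 0], 0 is not a gap, so the scan may start at 1. *)
  by apply/allP => -[|n] // /gapsP.
split.
- have /negP fM := f_notin _ _ (gaps_sorted M) gaps_gt0.
  by apply: contrapT => nfM; apply/fM/gapsP.
- by apply/eqP; rewrite -lt0n; apply: f_ge.
(* A nonzero [n] in [M] below the result would have been passed, hence be a gap. *)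
- move=> n Mn /eqP n0; rewrite leqNgt; apply/negP => nf.
  by apply: (iffLR (gapsP n)) Mn; apply: (@mem_lt_f 1); rewrite lt0n n0.
Qed.
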